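(* For each finite ordered alphabet $\mathbb A$ and each symmetric cyclic Abelian class $\mathfrak X$ over $\mathbb A$ we have $|\mathcal S_{alt}(\mathfrak X)|=1$. In particular, if $\mathbb A\subseteq\{2,3,4,\ldots\}$ (with the usual order), then each cyclic Abelian class $\mathcal C$ over $\mathbb A$ contains a unique (up to reversal) cyclic word $\omega$ with the property that $K^{\circlearrowright}(\omega)=\min\{K^{\circlearrowright}(\nu):\nu\in\mathcal C\}$.
   Context: Words: $\mathbb A^+$ (resp. $\mathbb A^*$) is the set of non-empty (resp. all) finite words over the finite non-empty totally ordered alphabet $\mathbb A$. For $x=x_1\cdots x_n$ put $x^*=x_n\cdots x_1$. A cyclic word over $\mathbb A$ is an equivalence class of $\mathbb A^+$ under $w\sim w'$ iff $w=pq$, $w'=qp$ for some $p,q\in\mathbb A^*$. ''$\omega=uv$'' means that $uv$ belongs to the class $\omega$. The reversal $\omega^*$ is the class of $x^*$ for any $x$ in $\omega$, and $\bar\omega=\{\omega,\omega^*\}$. A cyclic Abelian class $\mathcal C$ is the set of all cyclic words over $\mathbb A$ having a prescribed non-zero Parikh vector (number of occurrences of each letter); the corresponding symmetric cyclic Abelian class is $\mathfrak X=\{\bar\omega:\omega\in\mathcal C\}$. Alternating order (for words of equal length): if $x\ne y$ have equal length and $i$ is the first (1-based) index with $x_i\neq y_i$, then $x\prec_{alt}y$ iff ($i$ odd and $x_i<y_i$) or ($i$ even and $x_i>y_i$). A factorization $\omega=uv$ with $u,v\in\mathbb A^+$, $u\neq u^*$, $v\neq v^*$ is alt-synchronizing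 if ($u\prec_{alt}u^*\iff v\prec_{alt}v^*$). $\mathcal S_{alt}(\mathcal C)$ is the set of $\omega\in\mathcal C$ such that all factorizations $\omega=uv$ with $u\ne u^*$, $v\neq v^*$ are alt-synchronizing, and $\mathcal S_{alt}(\mathfrak X)=\{\bar\omega:\omega\in\mathcal S_{alt}(\mathcal C)\}$. Regular continuant: $K()=1$, $K(x_1)=x_1$, $K(x_1\cdots x_n)=x_nK(x_1\cdots x_{n-1})+K(x_1\cdots x_{n-2})$. Cyclic version: $K^{\circlearrowright}(x_1\cdots x_n)=K(x_1\cdots x_n)+K(x_2\cdots x_{n-1})$ for $n\ge2$ (for $n=1$ it is taken to be $x_1$). It is invariant under cyclic conjugation, hence well defined on cyclic words. *)

(* Defs.v *)
From HB Require Import structures.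
From mathcomp Require Export all_boot all_order finmap.
From mathcomp Require Export boolp classical_sets functions cardinality.

Set Implicit Arguments.
Unset Strict Implicit.
Unset Printing Implicit Defensive.

Local Open Scope classical_set_scope.
Local Open Scope quotient_scope.

(* The alphabet is a finite subset [A : {fset T}] of a totally ordered type
   [T], so that alphabets of integers keep the order of [nat]; words have
   letters in [T], and it is [cyclic_abelian_class A] that confines the letters
   to [A]. *)

Section CyclicWords.
Variables (d : Order.disp_t) (T : orderType d).

Record word := Word { wval :> seq T; _ : wval != [::] }.
HB.instance Definition _ := [isSub for wval].
HB.instance Definition _ := [Choice of word by <:].

Lemma wcat_subproof (u v : word) : u ++ v != [::] :> seq T.
Proof. by case: u => [[|a s] ?]. Qed.

Definition wcat (u v : word) : word := Word (wcat_subproof u v).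

Lemma wrev_subproof (w : word) : rev w != [::].
Proof. by rewrite -size_eq0 size_rev size_eq0 (valP w : wval w != [::]). Qed.

Definition wrev (w : word) : word := Word (wrev_subproof w).

Definition conjugate (w w' : word) : bool :=
  `[< exists p q : seq T, w = p ++ q :> seq T /\ w' = q ++ p :> seq T >].

Lemma conjugateP (w w' : word) :
  reflect (exists n, w' = rot n w :> seq T) (conjugate w w').
Proof.
apply: (iffP idP) => [/asboolP[p [q [-> ->]]]|[n e]].
  by exists (size p); rewrite rot_size_cat.
by apply/asboolP; exists (take n w), (drop n w); rewrite e cat_take_drop.
Qed.

Lemma conjugate_refl : reflexive conjugate.
Proof. by move=> w; apply/conjugateP; exists 0; rewrite rot0. Qed.

Lemma conjugate_sym : symmetric conjugate.
Proof.
by move=> w w'; apply/asboolP/asboolP => -[p [q [-> ->]]]; exists q, p.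
Qed.

Lemma conjugate_trans : transitive conjugate.
Proof.
move=> w2 w1 w3 /conjugateP[n e2] /conjugateP[m e3]; apply/conjugateP.
have rot_min (s : seq T) i : rot (minn i (size s)) s = rot i s.
  by case: (leqP i (size s)) => // /ltnW h; rewrite rot_size rot_oversize.
rewrite e3 e2 -(rot_min w1 n) -(rot_min (rot _ _) m) size_rot.
by rewrite rot_add_mod ?geq_minr //; eexists.
Qed.

Canonical conjugate_equiv :=
  EquivRel conjugate conjugate_refl conjugate_sym conjugate_trans.

Definition cword := {eq_quot conjugate_equiv}.
HB.instance Definition _ := EqQuotient.on cword.

Definition crev (o : cword) : cword := \pi_cword (wrev (repr o)).

Lemma crev_pi (x : word) : crev (\pi_cword x) = \pi_cword (wrev x).
Proof.
apply/eqmodP => /=; have : conjugate (repr (\pi_cword x)) x.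
  by apply/eqmodP; rewrite reprK.
case/asboolP=> p [q [e1 e2]]; apply/asboolP; exists (rev q), (rev p).
by rewrite /= e1 e2 !rev_cat.
Qed.

Definition bar (o : cword) : set cword := [set o; crev o].

Definition parikh (o : cword) (a : T) : nat := count_mem a (repr o).

Lemma parikh_pi (x : word) a : parikh (\pi_cword x) a = count_mem a x.
Proof.
have : conjugate (repr (\pi_cword x)) x by apply/eqmodP; rewrite reprK.
by case/asboolP=> p [q [e1 e2]]; rewrite /parikh e1 e2 !count_cat addnC.
Qed.

Definition cwords_over (A : {fset T}) : set cword :=
  [set o : cword | {subset wval (repr o) <= A}].

Definition cyclic_abelian_class (A : {fset T}) (C : set cword) : Prop :=
  exists p : A -> nat,
    (exists a, p a != 0) /\
    C = [set o : cword |
           cwords_over A o /\ forall a : A, parikh o (val a) = p a].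

Definition symmetrize (C : set cword) : set (set cword) := bar @` C.

Definition symmetric_cyclic_abelian_class
    (A : {fset T}) (X : set (set cword)) : Prop :=
  exists2 C, cyclic_abelian_class A C & X = symmetrize C.

(* The 1-based index of the first difference is [(size p).+1]. *)
Definition alt_lt (x y : seq T) : Prop :=
  size x = size y /\
  exists (p x' y' : seq T) (a b : T),
    [/\ x = p ++ a :: x', y = p ++ b :: y', a != b
      & if odd (size p).+1 then (a < b)%O else (b < a)%O].

Definition alt_synchronizing (u v : word) : Prop :=
  alt_lt u (wrev u) <-> alt_lt v (wrev v).

Definition S_alt (C : set cword) : set cword :=
  [set o : cword | C o /\ forall u v : word,
     o = \pi_cword (wcat u v) -> u <> wrev u -> v <> wrev v ->
     alt_synchronizing u v].

(* A symmetric class [X = symmetrize C] determines [C] as its union, see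
   [bigcup_symmetrize]. *)
Definition S_alt_sym (X : set (set cword)) : set (set cword) :=
  symmetrize (S_alt (\bigcup_(B in X) B)).

Lemma crev_class A C : cyclic_abelian_class A C -> forall o, C o -> C (crev o).
Proof.
case=> p [_ ->] o [oA op]; split.
  move=> a; rewrite -has_pred1 has_count -/(parikh (crev o) a) parikh_pi /=.
  by rewrite count_rev -has_count has_pred1; apply: oA.
by move=> a; rewrite parikh_pi /= count_rev; apply: op.
Qed.

Lemma bigcup_symmetrize A C : cyclic_abelian_class A C ->
  \bigcup_(B in symmetrize C) B = C.
Proof.
move=> AC; apply/seteqP; split => [o [_ [w Cw <-]] [->|->] //|o Co].
  exact: crev_class AC _ Cw.
by exists (bar o); [exists o | left].
Qed.

End CyclicWords.

(* [continuant_rev] reads the word backwards, so as to follow the recursion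
   K(x_1...x_n) = x_n K(x_1...x_{n-1}) + K(x_1...x_{n-2}). *)
Fixpoint continuant_rev (s : seq nat) : nat :=
  match s with
  | [::] => 1
  | x :: s1 => match s1 with
               | [::] => x
               | _ :: s2 => x * continuant_rev s1 + continuant_rev s2
               end
  end.

Definition continuant (w : seq nat) : nat := continuant_rev (rev w).

Lemma continuant_rcons w y x :
  continuant (rcons (rcons w y) x)
  = x * continuant (rcons w y) + continuant w.
Proof. by rewrite /continuant !rev_rcons. Qed.

Lemma continuant_cons x y w :
  continuant [:: x, y & w] = x * continuant (y :: w) + continuant w.
Proof.
have [n] := ubnP (size w); elim: n w y => // n IHn w y.
case/lastP: w => [|w z]; first by rewrite /continuant /= mulnC.
case/lastP: w => [|w t]; rewrite ?size_rcons ltnS => ltn.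
  by rewrite /continuant /= !mulnDr !muln1 (mulnC y x) mulnCA addnAC.
rewrite -[y :: _]/(rcons (rcons (y :: w) t) z).
rewrite -[x :: _]/(rcons (rcons [:: x, y & w] t) z) !continuant_rcons.
rewrite -[rcons [:: x, y & w] t]/[:: x, y & rcons w t].
rewrite -[rcons (y :: w) t]/(y :: rcons w t).
rewrite !IHn ?size_rcons ?(ltnW ltn) // !mulnDr mulnCA; exact: addnACA.
Qed.

(* [take (size w - 2) (behead w)] is x_2...x_{n-1}. *)
Definition cyclic_continuant_seq (w : seq nat) : nat :=
  if w is [:: x] then x
  else continuant w + continuant (take (size w - 2) (behead w)).

Definition cyclic_continuant (o : cword nat) : nat :=
  cyclic_continuant_seq (repr o).

Lemma cyclic_continuant_seq_rot n w :
  cyclic_continuant_seq (rot n w) = cyclic_continuant_seq w.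
Proof.
have rot1E s : cyclic_continuant_seq (rot 1 s) = cyclic_continuant_seq s.
  case: s => [|x [|y s]] //; rewrite rot1_cons.
  case/lastP: s => [|s z]; first
    by rewrite /cyclic_continuant_seq /continuant /= mulnC.
  have mid (t : seq nat) a b :
      cyclic_continuant_seq (a :: rcons t b)
      = continuant (a :: rcons t b) + continuant t.
    rewrite /cyclic_continuant_seq; case: t => [|e t] //=.
    by rewrite size_rcons subn2 /= -cats1 take_size_cat.
  rewrite -[y :: rcons s z]/(rcons (y :: s) z) mid.
  rewrite -[rcons (rcons _ _) _]/(y :: rcons (rcons s z) x) mid.
  rewrite -[y :: rcons _ _]/(rcons (rcons (y :: s) z) x) continuant_rcons.
  rewrite -[x :: _]/[:: x, y & rcons s z] continuant_cons.
  by rewrite -[y :: rcons s z]/(rcons (y :: s) z) addnAC.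
elim: n w => [|n IHn] w; first by rewrite rot0.
case: (ltnP n (size w)) => [ltn|len]; last by rewrite rot_oversize // ltnW.
by rewrite rotS // rot1E IHn.
Qed.

Lemma cyclic_continuant_pi (x : word nat) :
  cyclic_continuant (\pi_(cword nat) x) = cyclic_continuant_seq x.
Proof.
have : conjugate (repr (\pi_(cword nat) x)) x by apply/eqmodP; rewrite reprK.
by case/conjugateP => n ->; rewrite cyclic_continuant_seq_rot.
Qed.

Definition minimizes_cyclic_continuant (C : set (cword nat)) (o : cword nat) :
    Prop :=
  C o /\ forall o', C o' -> cyclic_continuant o <= cyclic_continuant o'.

(* Main.v *)
(** Write M(w) for the product of the matrices [[x, 1], [1, 0]] over the letters
    of w, so that the cyclic continuant of w is tr M(w).  Reversing u transposes
    M(u), hence tr M(uv) - tr M(u* v) = (M(u)_12 - M(u)_21)(M(v)_21 - M(v)_12).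
    The sign of M(u)_12 - M(u)_21 compares two continued fractions and is thus
    decided by the alternating order, so a minimal cyclic word has only
    synchronizing factorizations.  Relabelling letters by integers >= 2 gives
    existence over every alphabet.

    For uniqueness, such a word is reconstructed from a largest letter outwards:
    if s is the segment known so far, with low ends (say), then the next letter
    on either side must be the largest remaining one m, since otherwise reversing
    the factor from an occurrence of m up to that end of s is not synchronizing.
    Ties are harmless: they only move the segment to the reversal of s next to
    another occurrence of m. *)

Require Import Defs.
From mathcomp Require Import zify.

Set Implicit Arguments.
Unset Strict Implicit.
Unset Printing Implicit Defensive.

Import Order.TTheory.

Local Open Scope quotient_scope.

(** * The alternating order and zigzag segments *)

Section Alternating.
Context {d : Order.disp_t} {T : orderType d}.
Implicit Types (f : bool) (x y z : T) (s t u v R : seq T).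

Definition clt f x y := if f then (x < y)%O else (y < x)%O.
Definition cle f x y := if f then (x <= y)%O else (y <= x)%O.

(** The flag carries the parity of the current position: on words of equal length [alt true] is the
    alternating order and [alt false] its converse, which is also the order to use on suffixes
    starting at an even position. *)
Fixpoint alt f u v : bool :=
  match u, v with
  | x :: u', y :: v' => if x == y then alt (~~ f) u' v' else clt f x y
  | _, _ => false
  end.

Lemma cle_lt f x y : cle f x y -> x != y -> clt f x y.
Proof. by case: f => /= h n; rewrite lt_neqAle h ?n // eq_sym n. Qed.

Lemma cltN f x y : clt (~~ f) x y = clt f y x.
Proof. by case: f. Qed.

Lemma altN f u v : alt (~~ f) u v = alt f v u.
Proof.
elim: u v f => [|x u IH] [|y v] f //=.
by rewrite eq_sym; case: eqP => _; rewrite ?IH ?cltN.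
Qed.

Lemma alt_total f u v : size u = size v -> u != v -> alt f u v = ~~ alt f v u.
Proof.
elim: u v f => [|x u IH] [|y v] f //= [e]; rewrite eqseq_cons (eq_sym y).
case: eqP => [_|/eqP n _] /=; first exact: IH.
by rewrite /clt; case: f; rewrite -leNgt lt_neqAle ?n // eq_sym n.
Qed.

Lemma alt_catl f s u v : alt f (s ++ u) (s ++ v) = alt (f (+) odd (size s)) u v.
Proof.
elim: s f => [|x s IH] f /=; first by rewrite addbF.
by rewrite eqxx IH addNb addbN.
Qed.

Lemma alt_catr f u v s t : size u = size v -> alt f u v -> alt f (u ++ s) (v ++ t).
Proof.
elim: u v f => [|x u IH] [|y v] f //= [e].
by case: eqP => // _; apply: IH.
Qed.

Lemma alt_ltP u v : size u = size v -> alt_lt u v <-> alt true u v.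
Proof.
move=> e; split=> [[_ [p [u' [v' [a [b [-> -> n h]]]]]]]|].
  by rewrite alt_catl /= (negPf n); move: h => /=; case: (odd _).
move=> h; split=> //.
suff: exists (p u' v' : seq T) (a b : T),
  [/\ u = p ++ a :: u', v = p ++ b :: v', a != b
   & clt (true (+) odd (size p)) a b].
  by case=> p [u' [v' [a [b [-> -> n c]]]]]; exists p, u', v', a, b; split.
elim: u v true e h => [|x u IH] [|y v] f //= [e].
case: eqP => [<-|/eqP n] h.
  have [p [u' [v' [a [b [-> -> n c]]]]]] := IH _ _ e h.
  by exists (x :: p), u', v', a, b; split=> //=; move: c; rewrite addNb addbN.
by exists [::], u, v, x, y; rewrite addbF.
Qed.

(* [zig f s R]: the letters of [s] are alternately below (above) [R] and all
   letters of [s] closer to its ends; the ends of [s] are low if [f] and high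
   otherwise. *)
Inductive zig : bool -> seq T -> seq T -> Prop :=
| zig_one f x R : all (cle f x) R -> zig f [:: x] R
| zig_step f x s y R : zig (~~ f) s [:: x, y & R] ->
    all (cle f x) R -> all (cle f y) R -> zig f (x :: rcons s y) R.

Lemma zig_sub f s R R' : zig f s R -> {subset R' <= R} -> zig f s R'.
Proof.
move=> h; elim: h R' => {f s R} [f x R|f x s y R _ IH] h1.
  by move=> R' sub; constructor; apply/allP => z /sub; apply/allP.
move=> h2 R' sub; constructor.
- by apply: IH => z; rewrite !inE => /or3P[->|->|/sub->]; rewrite ?orbT.
- by apply/allP => z /sub; apply/allP.
- by apply/allP => z /sub; apply/allP.
Qed.

Lemma zig_rev f s R : zig f s R -> zig f (rev s) R.
Proof.
elim=> {f s R} [f x R|f x s y R _ IH] h1; first by constructor.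
move=> h2; rewrite rev_cons rev_rcons /=; constructor=> //.
by apply: zig_sub IH _ => z; rewrite !inE orbCA.
Qed.

Lemma odd_zig f s R : zig f s R -> odd (size s).
Proof. by elim=> {f s R} // f x s y R _ IH _ _ /=; rewrite size_rcons /= negbK. Qed.

(* Unless [s ++ t] precedes its reversal, it ends with a copy of [rev s]; the
   first alternative covers the case where this copy overlaps the initial [s]. *)
Lemma zig_cat f s R t : zig f s R -> {subset t <= R} -> t != [::] ->
  [\/ s ++ t = rev (s ++ t), exists r, t = r ++ rev s
    | alt f (s ++ t) (rev (s ++ t))].
Proof.
move=> h; elim: h t => {f s R} [f x R h1|f x s y R zs IH h1 h2];
  case/lastP=> // t z sub _.
  have zR : z \in R by apply: sub; rewrite mem_rcons mem_head.
  rewrite rev_cat rev_rcons /=; case: (eqVneq x z) => [<-|n].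
    by constructor 2; exists t; rewrite -cats1.
  by constructor 3; apply: cle_lt n; move/allP: h1; apply.
have zR : z \in R by apply: sub; rewrite mem_rcons mem_head.
set v := s ++ y :: t.
have -> : (x :: rcons s y) ++ rcons t z = x :: rcons v z.
  by rewrite /v /= rcons_cat /= cat_rcons.
case: (eqVneq x z) => [e|n]; last first.
  constructor 3; rewrite rev_cons rev_rcons /= (negPf n); apply: cle_lt n.
  by move/allP: h1; apply.
subst z.
have pal : v = rev v -> x :: rcons v x = rev (x :: rcons v x).
  by move=> e; rewrite rev_cons rev_rcons /= -e.
have sub' : {subset y :: t <= [:: x, y & R]}.
  move=> w; rewrite !inE => /orP[->|wt]; rewrite ?orbT //.
  by rewrite sub ?orbT // mem_rcons inE wt orbT.
case: (IH (y :: t) sub' isT) => [/pal|[[|y' r] e]|a]; first by constructor 1.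
- by constructor 1; apply: pal; rewrite /v e rev_cat revK.
- case: e => _; case/lastP: r => [|r w] e.
    by constructor 1; apply: pal; rewrite /v e rev_cat rev_cons revK cat_rcons.
  case: (eqVneq y w) => [->|n].
    constructor 2; exists r; rewrite e rev_cons rev_rcons /= -!cats1.
    by rewrite -!catA.
  constructor 3; rewrite /v e rev_cons rev_rcons /= eqxx.
  rewrite rev_cat rev_cons rev_cat revK rev_rcons cat_rcons -!cats1 -!catA /=.
  (* The word is x s y ... w (rev s) x. It first differs from its reversal after x s, which has even
     length, so the flag is again [f] there, and y is below w because w lies in [R]. *)
  rewrite alt_catl (odd_zig zs) addbT negbK /= (negPf n); apply: cle_lt n.
  move/allP: h2; apply; apply: sub.
  by rewrite e mem_rcons inE mem_cat mem_rcons mem_head /= orbT.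
- constructor 3; rewrite rev_cons rev_rcons /= eqxx -!cats1.
  by apply: alt_catr a; rewrite size_rev.
Qed.

(** * Words up to rotation and reversal, and synchronization *)

(** On non-empty words this is equality of cyclic words up to reversal. *)
Inductive cyc s : seq T -> Prop :=
| cyc_refl : cyc s s
| cyc_rot u v : cyc s (u ++ v) -> cyc s (v ++ u)
| cyc_rev u : cyc s u -> cyc s (rev u).

Lemma cyc_trans s t u : cyc s t -> cyc t u -> cyc s u.
Proof. by move=> st; elim=> // *; constructor. Qed.

Lemma cyc_sym s t : cyc s t -> cyc t s.
Proof.
elim=> [|u v _ h|u _ h]; first by constructor.
  by apply: cyc_trans h; do 2 constructor.
by apply: cyc_trans h; rewrite -{2}(revK u); do 2 constructor.
Qed.

Lemma cyc_perm s t : cyc s t -> perm_eq s t.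
Proof.
elim=> // [u v _|u _] h; first by rewrite (perm_trans h) // perm_catC.
by rewrite (perm_trans h) // perm_sym perm_rev.
Qed.

(** Factorizations of the reversed word are included to make the property invariant under [cyc].
    They add no condition: passing from u v to (rev v)(rev u) negates both comparisons. *)
Definition all_sync s := forall u v, cyc s (u ++ v) ->
  u != rev u -> v != rev v -> alt true u (rev u) = alt true v (rev v).

Lemma all_sync_cyc s t : cyc s t -> all_sync s -> all_sync t.
Proof. by move=> st h u v tuv; apply: h; apply: cyc_trans tuv. Qed.

(** The form used for contradictions: [alt] is irreflexive, so neither factor is a palindrome, and
    either value of the flag is allowed. *)
Lemma all_syncP f s u v : all_sync s -> cyc s (u ++ v) ->
  alt f u (rev u) -> alt f (rev v) v -> False.
Proof.
have irr w g : alt g w w = false by elim: w g => //= x w IH g; rewrite eqxx.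
move=> h c au av.
have nu : u != rev u by apply: contraTneq au => <-; rewrite irr.
have nv : v != rev v by apply: contraTneq av => <-; rewrite irr.
have := h u v c nu nv; case: f au av => au av.
  by rewrite au (alt_total _ _ nv) ?size_rev // av.
rewrite -[false]/(~~ true) !altN in au av.
by rewrite av (alt_total _ _ nu) ?size_rev // au.
Qed.

(** * Extending a known segment by an extreme letter *)

(** Cut at an occurrence of [m] into [s ++ r1] and the rest. If the letter before [s] is not [m],
    the rest comes after its reversal in the order [f], so [s ++ r1] cannot come before its own. By
    [zig_cat], or by the orientation of [s] if r1 is empty, it then ends with [rev s], which is
    followed by [m]. *)
Lemma extend_left f s r m : zig f s r -> s = rev s \/ alt f s (rev s) ->
  all_sync (s ++ r) -> m \in r -> all (cle (~~ f) m) r ->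
  exists t, cyc (s ++ r) (m :: s ++ t).
Proof.
move=> zs os sy mr mx; case/splitPr: mr mx zs sy => r1 r2 mx zs sy.
case/lastP: r2 mx zs sy => [|r2 z] mx zs sy.
  by exists r1; apply: (@cyc_rot _ (s ++ r1) [:: m]); rewrite -catA; constructor.
case: (eqVneq m z) => [<-|n].
  exists (r1 ++ m :: r2); apply: (@cyc_rot _ (s ++ r1 ++ m :: r2) [:: m]).
  by rewrite -!catA /= cats1; constructor.
have c : cyc (s ++ r1 ++ m :: rcons r2 z) ((s ++ r1) ++ m :: rcons r2 z).
  by rewrite catA; constructor.
have au : alt f (rev (m :: rcons r2 z)) (m :: rcons r2 z).
  rewrite -altN rev_cons rev_rcons /= (negPf n); apply: cle_lt n.
  by move/allP: mx; apply; rewrite !(mem_cat, inE, mem_rcons) eqxx !orbT.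
(* Read backwards, [rev s] followed by [m] becomes [m] followed by [s]. *)
have key r3 : s ++ r1 = r3 ++ rev s ->
    exists t, cyc (s ++ r1 ++ m :: rcons r2 z) (m :: s ++ t).
  move=> e; exists (rev r3 ++ rev (rcons r2 z)).
  apply: (@cyc_rot _ (s ++ rev r3 ++ rev (rcons r2 z)) [:: m]).
  rewrite (_ : (s ++ rev r3 ++ rev (rcons r2 z)) ++ [:: m] =
      rev ((m :: rcons r2 z) ++ (r3 ++ rev s))); last first.
    by rewrite !rev_cat revK rev_cons -!catA cats1.
  by apply/cyc_rev/cyc_rot; rewrite -e -catA; constructor.
case: (eqVneq r1 [::]) => [e1|n1].
  case: os => [es|a]; first by apply: (key [::]); rewrite e1 cats0.
  by case: (all_syncP (f := f) sy c _ au); rewrite e1 cats0.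
have sub : {subset r1 <= r1 ++ m :: rcons r2 z}.
  by move=> w; rewrite mem_cat => ->.
case: (zig_cat zs sub n1) => [e|[r3 e]|a].
- by apply: (key (rev r1)); rewrite -rev_cat.
- by apply: (key (s ++ r3)); rewrite -catA -e.
- by case: (all_syncP sy c a au).
Qed.

(** The letter [h] before [s] must be kept. If z other than [m] follows [s], the factor from z to
    [m] comes before its reversal, so [r2 ++ h :: s] cannot come after its own. It then begins with
    [rev s] and [h], and the word read backwards contains h s m. *)
Lemma extend_right f s r h m : zig f s (h :: r) -> all (cle (~~ f) h) r ->
  all_sync (h :: s ++ r) -> m \in r -> all (cle (~~ f) m) r ->
  exists t, cyc (h :: s ++ r) (h :: s ++ m :: t).
Proof.
move=> zs hx sy mr mx; case/splitPr: mr hx mx zs sy => r1 r2 hx mx zs sy.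
case: r1 hx mx zs sy => [|z r1] hx mx zs sy; first by exists r2; constructor.
case: (eqVneq m z) => [<-|n].
  by exists (r1 ++ m :: r2); constructor.
set c0 := h :: _.
have c : cyc c0 (((z :: rcons r1 m)) ++ (r2 ++ h :: s)).
  rewrite catA; constructor; rewrite /c0 /= cat_rcons; constructor.
have au : alt f (z :: rcons r1 m) (rev (z :: rcons r1 m)).
  rewrite rev_cons rev_rcons /= eq_sym (negPf n) -cltN; apply: cle_lt n.
  by move/allP: mx; apply; rewrite mem_head.
have key r3 : r2 ++ h :: s = rev s ++ h :: r3 ->
    exists t, cyc c0 (h :: s ++ m :: t).
  move=> e; exists (rev (z :: r1) ++ rev r3).
  apply: (@cyc_rot _ (m :: rev (z :: r1) ++ rev r3) (h :: s)).
  rewrite (_ : _ ++ h :: s = rev ((r2 ++ h :: s) ++ z :: rcons r1 m)).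
    by apply/cyc_rev/cyc_rot.
  by rewrite e !rev_cat !rev_cons rev_rcons revK /= cat_rcons -catA !cat_rcons.
have sub : {subset h :: rev r2 <= h :: (z :: r1) ++ m :: r2}.
  move=> w; rewrite !(mem_cat, inE, mem_rev).
  by move=> /orP[->|->]; rewrite ?orbT.
have ew : rev (rev s ++ h :: rev r2) = r2 ++ h :: s.
  by rewrite rev_cat rev_cons !revK cat_rcons.
case: (zig_cat (zig_rev zs) sub isT) => [e|[r3 e]|a].
- rewrite ew in e; by apply: (key (rev r2)).
- rewrite revK in e; case: r3 e => [|h' r3] /=.
    by move=> e; apply: (key (rev r2)); rewrite -e rev_cons revK cat_rcons.
  case=> _; case/lastP: r3 => [|r3 w] e.
    have er : r2 = rev s by rewrite -[r2]revK e.
    by apply: (key (rev r2)); rewrite er revK.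
  have er : r2 = rev s ++ w :: rev r3.
    by rewrite -[r2]revK e rev_cat rev_rcons.
  case: (eqVneq h w) => [ehw|nhw].
    by apply: (key (rev r3 ++ h :: s)); rewrite {1}er -ehw -catA.
  (* Now [r2 ++ h :: s] is (rev s) w ... h s. Past the odd length of [rev s] the flag is [~~ f], for
     which the extreme letter [h] comes before w. *)
  exfalso; apply: (all_syncP sy c au).
  rewrite rev_cat rev_cons er cat_rcons -catA alt_catl size_rev (odd_zig zs).
  rewrite addbT /= (negPf nhw); apply: cle_lt nhw.
  by move/allP: hx; apply; rewrite er !(mem_cat, inE) eqxx !orbT.
- by case: (all_syncP (f := f) sy c au); rewrite -ew revK.
Qed.

(** * Uniqueness of the synchronizing word *)

Lemma extremum f R : R != [::] ->
  exists m R', perm_eq R (m :: R') /\ all (cle f m) R.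
Proof.
have tot x y : cle f x y || cle f y x by case: f; apply: le_total.
have tr : transitive (cle f).
  case: (f) => y x z; last by move=> a b; apply: le_trans b a.
  exact: le_trans.
move=> n; have : perm_eq (sort (cle f) R) R by rewrite perm_sort.
have := sort_sorted tot R.
case: (sort _ _) => [|m R'].
  by move=> _; rewrite perm_sym => /perm_size/size0nil e; rewrite e in n.
rewrite /= path_sortedE // => /andP[h _] p; exists m, R'; rewrite perm_sym.
split=> //; rewrite -(perm_all _ p) /= h andbT.
by case: f {tot tr h p} => /=.
Qed.

(** Induction on the number of remaining letters: the two most extreme ones, [m] and [m'], are
    forced next to [s], and the flag flips. The choice of both depends on [R] only, so z serves all
    words x at once. *)
Lemma common_completion f s R : zig f s R -> s = rev s \/ alt f s (rev s) ->
  exists z : seq T, forall x : seq T, perm_eq x (s ++ R) -> all_sync x ->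
    (exists t, cyc x (s ++ t)) -> cyc x z.
Proof.
have perm_rest (x : seq T) s0 R0 t :
    perm_eq x (s0 ++ R0) -> cyc x (s0 ++ t) -> perm_eq t R0.
  move=> p /cyc_perm c; rewrite -(perm_cat2l s0).
  by apply: perm_trans p; rewrite perm_sym.
have [n] := ubnP (size R); elim: n f s R => // n IH f s R ltn zs os.
case: (eqVneq R [::]) => [->|nR].
  exists s => x px _ [t c]; have := perm_rest _ _ _ _ px c.
  by move/perm_size/size0nil => e; rewrite e cats0 in c.
have [m [R1 [p1 mx]]] := extremum (~~ f) nR.
have step1 (x : seq T) : perm_eq x (s ++ R) -> all_sync x ->
    (exists t, cyc x (s ++ t)) -> exists t, cyc x (m :: s ++ t).
  move=> px sx [t c]; have pt := perm_rest _ _ _ _ px c.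
  have zt : zig f s t by apply: zig_sub zs _ => z; rewrite (perm_mem pt).
  have [||t' c'] := extend_left zt os (all_sync_cyc c sx) (m := m).
  - by rewrite (perm_mem pt) (perm_mem p1) mem_head.
  - by rewrite (perm_all _ pt).
  by exists t'; apply: cyc_trans c'.
have mx1 : all (cle (~~ f) m) R1.
  by move: mx; rewrite (perm_all _ p1) => /andP[].
have px1 (x : seq T) : perm_eq x (s ++ R) -> perm_eq x ((m :: s) ++ R1).
  move/perm_trans; apply; rewrite perm_sym -[_ ++ R1]cat1s perm_catCA perm_cat2l.
  by rewrite perm_sym.
case: (eqVneq R1 [::]) => [e1|nR1].
  exists (m :: s) => x px sx ex; have [t c] := step1 x px sx ex.
  have := perm_rest _ (m :: s) _ t (px1 _ px) c.
  by rewrite e1 => /perm_size/size0nil e; rewrite e cats0 in c.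
have [m' [R2 [p2 mx2]]] := extremum (~~ f) nR1.
have mx2' : all (cle (~~ f) m') R2.
  by move: mx2; rewrite (perm_all _ p2) => /andP[].
have mm' : cle (~~ f) m m'.
  by move/allP: mx1; apply; rewrite (perm_mem p2) mem_head.
have step2 (x : seq T) : perm_eq x (s ++ R) -> all_sync x ->
    (exists t, cyc x (s ++ t)) -> exists t, cyc x ((m :: rcons s m') ++ t).
  move=> px sx ex; have [t c] := step1 x px sx ex.
  have pt := perm_rest _ (m :: s) _ _ (px1 _ px) c.
  have zt : zig f s (m :: t).
    by apply: zig_sub zs _ => z; rewrite (perm_mem p1) !inE (perm_mem pt).
  have [|||t' c'] := extend_right zt _ (all_sync_cyc c sx) (m := m').
  - by rewrite (perm_all _ pt).
  - by rewrite (perm_mem pt) (perm_mem p2) mem_head.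
  - by rewrite (perm_all _ pt).
  by exists t'; rewrite /= cat_rcons; apply: cyc_trans c'.
have [||| z hz] := IH (~~ f) (m :: rcons s m') R2.
- by move: ltn; rewrite (perm_size p1) /= (perm_size p2) /= !ltnS; apply: ltnW.
- constructor=> //; last by move: mx1; rewrite (perm_all _ p2) => /andP[].
  rewrite negbK; apply: zig_sub zs _ => z.
  by rewrite (perm_mem p1) !inE (perm_mem p2) !inE.
(* The more extreme letter [m] stands on the left, which orients the new segment; if [m] and [m']
   agree, the orientation is inherited from [s]. *)
- rewrite rev_cons rev_rcons /=; case: (eqVneq m m') => [<-|nm]; last first.
    by right; apply: cle_lt nm.
  case: os => [<-|a]; [by left | right].
  by rewrite negbK -!cats1; apply: alt_catr a; rewrite size_rev.
exists z => x px sx ex; apply: hz => //; last exact: step2.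
apply: perm_trans (px1 _ px) _; rewrite /= perm_cons cat_rcons perm_cat2l.
exact: p2.
Qed.

Lemma all_sync_unique (x y : seq T) : perm_eq x y -> all_sync x -> all_sync y -> cyc x y.
Proof.
case: (eqVneq x [::]) => [-> p _ _|nx p sx sy].
  by move/perm_size/esym/size0nil: p => ->; constructor.
(* The initial segment is a single largest letter: a palindrome with high ends that occurs in both
   words. *)
have [m [R [pm mx]]] := extremum false nx.
have zm : zig false [:: m] R.
  by constructor; move: mx; rewrite (perm_all _ pm) => /andP[].
have [|z hz] := common_completion zm; first by left.
have first_letter (w : seq T) : m \in w -> exists t, cyc w ([:: m] ++ t).
  case/splitPr=> w1 w2; exists (w2 ++ w1); rewrite catA.
  by do 2 constructor.
have mm : m \in x by rewrite (perm_mem pm) mem_head.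
have xz : cyc x z by apply: hz => //; apply: first_letter.
apply: cyc_trans xz _; apply: cyc_sym; apply: hz => //.
  by rewrite perm_sym in p; apply: perm_trans p _.
by apply: first_letter; rewrite -(perm_mem p).
Qed.

End Alternating.

(** * Continuants as entries of matrix products *)

Section Continuants.
Implicit Types (f : bool) (u v w : seq nat).

(* The entries (a, b, c, d) of the product of the matrices [[x, 1], [1, 0]]
   over the letters x of [w], listed row by row. *)
Fixpoint cont_mx w : nat * nat * nat * nat :=
  if w is x :: w' then
    let: (a, b, c, d) := cont_mx w' in (x * a + c, x * b + d, a, b)
  else (1, 0, 0, 1).

Lemma cont_mx_cat u v :
  cont_mx (u ++ v) =
  let: (a, b, c, d) := cont_mx u in let: (a', b', c', d') := cont_mx v in
  (a * a' + b * c', a * b' + b * d', c * a' + d * c', c * b' + d * d').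
Proof.
elim: u => [|x u IH] /=.
  by case: (cont_mx v) => [[[a b] c] d]; rewrite !mul1n !mul0n !addn0.
rewrite IH; case: (cont_mx u) => [[[a b] c] d].
by case: (cont_mx v) => [[[a' b'] c'] d']; congr (_, _, _, _); nia.
Qed.

Lemma cont_mx_rev u :
  cont_mx (rev u) = let: (a, b, c, d) := cont_mx u in (a, c, b, d).
Proof.
elim: u => [|x u IH] //=; rewrite rev_cons -cats1 cont_mx_cat IH.
case: (cont_mx u) => [[[a b] c] d] /=; congr (_, _, _, _); lia.
Qed.

Lemma cont_mx_continuant x w :
  (cont_mx (x :: w)).1.1.1 = continuant (x :: w) /\
  (cont_mx (x :: w)).1.2 = continuant w.
Proof.
elim: w x => [|y w IH] x; first by rewrite /continuant /=; split; lia.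
have [e1 e2] := IH y; rewrite continuant_cons -e1 -e2 /=.
by case: (cont_mx w) => [[[a b] c] d].
Qed.

(** The lower right entry is the continuant of the inner letters: it is the upper right entry once
    the first letter is dropped, hence, by transposition, the lower left entry for the reversed
    word. *)
Lemma cyclic_continuant_trace w : w != [::] ->
  cyclic_continuant_seq w = let: (a, _, _, d) := cont_mx w in a + d.
Proof.
case: w => [|x w] // _; case/lastP: w => [|w y]; first by rewrite /= muln1 !addn0.
have [e _] := cont_mx_continuant x (rcons w y).
have [_ e'] := cont_mx_continuant y (rev w).
have er : continuant (rev w) = continuant w.
  case: w {e e'} => [|z t] //; have [<- _] := cont_mx_continuant z t.
  have : rev (z :: t) != [::] by rewrite -size_eq0 size_rev.
  case E : (rev _) => [|z' t'] // _; have [<- _] := cont_mx_continuant z' t'.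
  by rewrite -E cont_mx_rev; case: (cont_mx _) => [[[a b] c] d].
rewrite /cyclic_continuant_seq; case E : (rcons w y) => [|z t].
  by case: w E {e er e'}.
rewrite -E -e /= size_rcons subn2 /=.
have -> : take (size w) (rcons w y) = w by rewrite -cats1 take_size_cat.
rewrite -er -e' -rev_rcons cont_mx_rev.
by case: (cont_mx (rcons w y)) => [[[a b] c] d].
Qed.

Lemma cyclic_continuant_seq_cyc u v : cyc u v ->
  cyclic_continuant_seq u = cyclic_continuant_seq v.
Proof.
elim=> // [s t _ ->|s _ ->].
  by rewrite -(rot_size_cat s t) cyclic_continuant_seq_rot.
case: (eqVneq s [::]) => [->|n] //.
rewrite !cyclic_continuant_trace -?size_eq0 ?size_rev ?size_eq0 //.
by rewrite cont_mx_rev; case: (cont_mx s) => [[[a b] c] d].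
Qed.

(* [c / a] is the continued fraction [0; x_1, ..., x_n]. *)
Lemma alt_cont_mx f u v : size u = size v ->
  all (leq 2) u -> all (leq 2) v -> alt f u v ->
  let: (a, _, c, _) := cont_mx u in let: (a', _, c', _) := cont_mx v in
  if f then c' * a < c * a' else c * a' < c' * a.
Proof.
(* Since c / a lies in [0, 1), the first differing letter decides between the values x + c / a; each
   inversion reverses the comparison. *)
have pos w : all (leq 2) w ->
    let: (a, _, c, _) := cont_mx w in c < a.
  elim: w => [|x w IH] //= /andP[x2 /IH].
  by case: (cont_mx w) => [[[a b] c] e]; nia.
elim: u v f => [|x u IH] [|y v] f //= [e] /andP[x2 u2] /andP[y2 v2].
have := pos u u2; have := pos v v2.
case: eqP => [<-|_] h1 h2 h; last first.
  move: h h1 h2; rewrite /clt.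
  case: (cont_mx u) => [[[a b] c] ?]; case: (cont_mx v) => [[[a' b'] c'] ?].
  by case: f; rewrite ltEnat /= => /subnK <-; nia.
have := IH v (~~ f) e u2 v2 h.
case: (cont_mx u) => [[[a b] c] ?]; case: (cont_mx v) => [[[a' b'] c'] ?].
by case: f {h} => /=; nia.
Qed.

End Continuants.

(** * Existence through minimal cyclic continuants *)

Section Existence.
Context {d : Order.disp_t} {T : orderType d}.
Implicit Types (g : T -> nat) (s u v : seq T).

Lemma alt_map f g u v : {in u ++ v &, {mono g : x y / (x <= y)%O >-> x <= y}} ->
  alt f (map g u) (map g v) = alt f u v.
Proof.
elim: u v f => [|x u IH] [|y v] f //= gm.
have xm : x \in x :: u ++ y :: v by rewrite mem_head.
have ym : y \in x :: u ++ y :: v by rewrite inE mem_cat mem_head !orbT.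
have -> : (g x == g y) = (x == y) by rewrite eqn_leq eq_le !gm.
rewrite IH => [|a b ha hb].
  by rewrite /clt !ltEnat /= !ltnNge !gm // -!ltNge.
by apply: gm; [move: ha | move: hb]; rewrite !(inE, mem_cat);
  case/orP=> ->; rewrite ?orbT.
Qed.

Lemma cyc_map g s t : cyc s t -> cyc (map g s) (map g t).
Proof.
elim=> [|u v _|u _]; first by constructor.
  by rewrite !map_cat; apply: cyc_rot.
by rewrite map_rev; apply: cyc_rev.
Qed.

(** In a factorization that is not synchronizing, reversing u would strictly lower the trace. *)
Lemma all_sync_minimal g s : {in s &, {mono g : x y / (x <= y)%O >-> x <= y}} ->
  all (leq 2) (map g s) ->
  (forall t, perm_eq t s ->
     cyclic_continuant_seq (map g s) <= cyclic_continuant_seq (map g t)) ->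
  all_sync s.
Proof.
move=> gm g2 min u v c nu nv.
have suv := cyc_perm c.
have key f : alt f u (rev u) -> alt (~~ f) v (rev v) -> False.
  have uvP w : {subset w <= u ++ v} ->
      all (leq 2) (map g w) /\
      {in w ++ rev w &, {mono g : x y / (x <= y)%O >-> x <= y}}.
    move=> sub; split.
      apply/allP=> _ /mapP[x /sub xw ->]; move/allP: g2; apply.
      by apply: map_f; rewrite (perm_mem suv).
    by move=> x y; rewrite !mem_cat !mem_rev !orbb => /sub xw /sub yw;
      apply: gm; rewrite (perm_mem suv).
  have [|u2 um] := uvP u; first by move=> x; rewrite mem_cat => ->.
  have [|v2 vm] := uvP v; first by move=> x; rewrite mem_cat orbC => ->.
  rewrite -(alt_map _ um) -(alt_map _ vm) => au av.
  have := alt_cont_mx _ u2 _ au; have := alt_cont_mx _ v2 _ av.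
  rewrite !size_map !size_rev !map_rev !all_rev => /(_ erefl v2) hv /(_ erefl u2).
  move: hv; rewrite !cont_mx_rev.
  have : cyclic_continuant_seq (map g (u ++ v))
      <= cyclic_continuant_seq (map g (rev u ++ v)).
    rewrite -(cyclic_continuant_seq_cyc (cyc_map g c)); apply: min.
    rewrite perm_sym; apply: perm_trans suv _.
    by rewrite perm_cat2r perm_sym perm_rev.
  have nz w : w != rev w -> map g (w ++ v) != [::] by case: w.
  have nz' : map g (rev u ++ v) != [::].
    by rewrite -size_eq0 size_map size_cat size_rev; case: (u) nu.
  rewrite !cyclic_continuant_trace ?nz' ?(nz u) // !map_cat map_rev.
  rewrite !cont_mx_cat cont_mx_rev.
  case: (cont_mx (map g u)) => [[[a b] e] h].
  case: (cont_mx (map g v)) => [[[a' b'] e'] h'].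
  by case: f {au av} => /= le; rewrite !ltn_mul2r => /andP[_ lv] /andP[_ lu]; nia.
case E : (alt true u (rev u)); case F : (alt true v (rev v)) => //.
  by case: (key true E); rewrite alt_total ?size_rev // altN F.
by case: (key false _ F); rewrite -[false]/(~~ true) altN;
  rewrite alt_total ?size_rev 1?eq_sym // E.
Qed.

Lemma exists_minimal g s : exists2 t, perm_eq t s & forall t', perm_eq t' t ->
  cyclic_continuant_seq (map g t) <= cyclic_continuant_seq (map g t').
Proof.
pose F t := cyclic_continuant_seq (map g t).
pose P n := has (fun t => F t == n) (permutations s).
have exP : exists n, P n.
  by exists (F s); apply/hasP; exists s; rewrite ?mem_permutations.
case: (ex_minnP exP) => n /hasP[t]; rewrite mem_permutations => ts /eqP <- min.
exists t => // t' t't; apply: min; apply/hasP; exists t' => //.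
by rewrite mem_permutations (perm_trans t't).
Qed.

Lemma exists_all_sync s : exists2 t, perm_eq t s & all_sync t.
Proof.
(* Ranks within [s], shifted by 2 to meet the lower bound on letters. *)
pose g x := 2 + count (fun y => (y < x)%O) s.
have [t ts min] := exists_minimal g s; exists t => //.
apply: all_sync_minimal min; last by apply/allP => _ /mapP[x _ ->].
have hom x y : (x <= y)%O -> g x <= g y.
  move=> xy; rewrite leq_add2l; apply: sub_count => z /= zx.
  exact: lt_le_trans zx xy.
move=> x y; rewrite !(perm_mem ts) => xs ys.
case: (leP x y) => [/hom //|yx]; apply/negbTE; rewrite -ltnNge ltn_add2l.
(* Strictness: the occurrences of y itself count for x but not for y. *)
have : count (fun z => (z < y)%O || (z == y)) s <= count (fun z => (z < x)%O) s.
  by apply: sub_count => z /= /orP[zy|/eqP->] //; apply: lt_trans yx.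
apply: leq_trans; have := count_predUI (fun z => (z < y)%O) (pred1 y) s.
rewrite [count (predI _ _) _](_ : _ = 0) ?addn0 => [->|].
  by rewrite -addn1 leq_add2l -has_count has_pred1.
by apply/eqP; rewrite -leqn0 leqNgt -has_count; apply/hasPn => z _ /=;
  case: eqP => [->|]; rewrite ?ltxx ?andbF.
Qed.

End Existence.

(** * Transfer to cyclic words and Abelian classes *)

Section CyclicWordClasses.
Context {d : Order.disp_t} {T : orderType d}.
Implicit Types (A : {fset T}) (C : set (cword T)) (o : cword T) (x y : word T).

Lemma word_of_seq (s : seq T) : s != [::] -> exists x, wval x = s.
Proof. by move=> n; exists (Word n). Qed.

Lemma cword_repr o : exists x, o = \pi_(cword T) x.
Proof. by exists (repr o); rewrite reprK. Qed.

Lemma pi_cat (u v : seq T) x y : wval x = u ++ v -> wval y = v ++ u ->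
  \pi_(cword T) x = \pi_(cword T) y.
Proof. by move=> ex ey; apply/eqmodP/asboolP; exists u, v. Qed.

Lemma crevK o : crev (crev o) = o.
Proof.
have [x ->] := cword_repr o; rewrite !crev_pi; congr (\pi_(cword T) _).
by apply: val_inj; exact: revK.
Qed.

Lemma cyc_pi x y : cyc x y ->
  \pi_(cword T) y = \pi_(cword T) x \/ \pi_(cword T) y = crev (\pi_(cword T) x).
Proof.
suff h s : cyc x s -> forall y, wval y = s ->
    \pi_(cword T) y = \pi_(cword T) x \/ \pi_(cword T) y = crev (\pi_(cword T) x).
  by move/h; apply.
elim=> {s} [|u v _ IH|u _ IH] z ez.
- by left; congr (\pi_(cword T) _); apply: val_inj.
- have [|z' ez'] := @word_of_seq (u ++ v).
    have := valP z; rewrite /= ez -!size_eq0 !size_cat; lia.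
  by rewrite (pi_cat ez ez'); apply: IH.
- have eu : wval (wrev z) = u by rewrite /= ez revK.
  rewrite -[\pi_(cword T) z]crevK crev_pi; case: (IH _ eu) => ->; first by right.
  by left; rewrite crevK.
Qed.

Lemma pi_eq_cyc x y : \pi_(cword T) x = \pi_(cword T) y -> cyc x y.
Proof.
by move=> /eqmodP /asboolP[p [q [ep ->]]]; apply: cyc_rot; rewrite -ep; constructor.
Qed.

Lemma S_altP C x : C (\pi_(cword T) x) ->
  S_alt C (\pi_(cword T) x) <-> all_sync x.
Proof.
have syncE (u v : word T) : alt_synchronizing u v <->
    alt true u (rev u) = alt true v (rev v).
  rewrite /alt_synchronizing !alt_ltP ?size_rev //=.
  by split=> [[h h']|->//]; apply/idP/idP.
have neqE (u : word T) : u <> wrev u <-> wval u != rev u.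
  by split=> [h|/eqP h e]; [apply/eqP => e; apply/h/val_inj | apply: h; rewrite {1}e].
move=> Cx; split=> [[_ h] u v c nu nv|h].
  have [|wu eu] := @word_of_seq u; first by case: (u) nu.
  have [|wv ev] := @word_of_seq v; first by case: (v) nv.
  subst u v; case: (cyc_pi (y := wcat wu wv) c) => e.
    by apply/syncE; apply: h; rewrite ?neqE.
  (* Here u v represents the reversal of the cyclic word, so (rev v)(rev u) factors the word
     itself. *)
  have := h (wrev wv) (wrev wu); rewrite syncE !neqE /= !revK.
  rewrite -[\pi_(cword T) x]crevK -e crev_pi => /(_ _ _ _) k.
  have := k _ _ _; rewrite (alt_total _ _ nu) ?size_rev //.
  rewrite (alt_total _ _ nv) ?size_rev //.
  move=> -> //; first by congr (\pi_(cword T) _); apply: val_inj; rewrite /= rev_cat.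
  - by rewrite eq_sym.
  - by rewrite eq_sym.
split=> // u v e; rewrite !neqE syncE => nu nv; apply: h => //.
exact: (pi_eq_cyc e).
Qed.

Lemma cwords_over_pi A x :
  cwords_over A (\pi_(cword T) x) <-> {subset wval x <= A}.
Proof.
have memE a : (a \in wval (repr (\pi_(cword T) x))) = (a \in wval x).
  by rewrite -!has_pred1 !has_count -(parikh_pi x).
by split=> h a; [rewrite -memE | rewrite memE]; apply: h.
Qed.

Lemma cyclic_abelian_class_perm A C x y : cyclic_abelian_class A C ->
  C (\pi_(cword T) x) -> C (\pi_(cword T) y) <-> perm_eq y x.
Proof.
case=> p [_ ->] [/cwords_over_pi xA xp]; split.
  case=> /cwords_over_pi yA yp; apply/allP => a _ /=.
  case aA : (a \in A).
    by rewrite -!parikh_pi -[a]/(val (FSetSub aA)) xp yp.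
  have out (z : word T) : {subset wval z <= A} -> count_mem a z = 0.
    by move=> zA; apply/count_memPn; apply: contraFN aA => /zA.
  by rewrite !out.
move=> yx; split.
  by apply/cwords_over_pi => a; rewrite (perm_mem yx); apply: xA.
by move=> a; rewrite parikh_pi (permP yx) -parikh_pi.
Qed.

Lemma cyclic_abelian_class_nonempty A C : cyclic_abelian_class A C ->
  exists x, C (\pi_(cword T) x).
Proof.
case=> p [[a0 pa0] ->].
pose s := flatten [seq nseq (p a) (val a) | a <- enum {: A}].
have sc (a : A) : count_mem (val a) s = p a.
  rewrite count_flatten -map_comp sumnE big_map big_enum /= (bigD1 a) //=.
  rewrite count_nseq /= eqxx mul1n big1 ?addn0 // => b ba.
  by rewrite count_nseq /= (inj_eq val_inj) (negPf ba).
have [|x ex] := @word_of_seq s.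
  by apply: contraNneq pa0 => e; rewrite -sc e.
exists x; split=> [|a]; last by rewrite parikh_pi ex sc.
apply/cwords_over_pi => a; rewrite ex => /flatten_mapP[b _].
by rewrite mem_nseq => /andP[_ /eqP->]; apply: valP.
Qed.

Lemma bar_cyc x y : cyc x y -> bar (\pi_(cword T) y) = bar (\pi_(cword T) x).
Proof.
by case/cyc_pi => ->; rewrite /bar ?crevK // setUC.
Qed.

Lemma S_alt_bar A C o o' : cyclic_abelian_class A C ->
  S_alt C o -> S_alt C o' -> bar o' = bar o.
Proof.
have [[x ->] [y ->]] := (cword_repr o, cword_repr o').
move=> hC So So'; have [[Cx _] [Cy _]] := (So, So').
apply: bar_cyc; apply: all_sync_unique.
- by rewrite perm_sym; apply/(cyclic_abelian_class_perm _ hC).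
- exact/(S_altP Cx).
- exact/(S_altP Cy).
Qed.

Lemma S_alt_nonempty A C : cyclic_abelian_class A C -> exists o, S_alt C o.
Proof.
move=> hC; have [x Cx] := cyclic_abelian_class_nonempty hC.
have [s sx sy] := exists_all_sync x.
have [|y ey] := @word_of_seq s.
  by rewrite -size_eq0 (perm_size sx) size_eq0 (valP x : wval x != [::]).
subst s; exists (\pi_(cword T) y); apply/S_altP => //.
exact/(cyclic_abelian_class_perm _ hC Cx).
Qed.

End CyclicWordClasses.

(** * Minimizers over integer alphabets *)

(** The letters are already integers at least 2, so the identity serves as relabelling. *)
Lemma minimizer_S_alt (A : {fset nat}) (C : set (cword nat)) (o : cword nat) :
  (forall a : nat, a \in A -> 2 <= a) -> cyclic_abelian_class A C ->
  minimizes_cyclic_continuant C o -> S_alt C o.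
Proof.
have [x ->] := cword_repr o; move=> A2 hC [Cx min].
apply/S_altP => //; apply: (@all_sync_minimal _ _ id).
- by move=> a b _ _; rewrite leEnat.
- rewrite map_id; apply/allP => a ax; apply: A2.
  by case: hC Cx => p [_ ->] [/cwords_over_pi + _]; apply.
move=> t tx; rewrite !map_id; have [|y ey] := @word_of_seq _ _ t.
  by rewrite -size_eq0 (perm_size tx) size_eq0 (valP x : wval x != [::]).
rewrite -ey -!cyclic_continuant_pi; apply: min.
by apply/(cyclic_abelian_class_perm _ hC Cx); rewrite ey.
Qed.

Lemma minimizer_exists (A : {fset nat}) (C : set (cword nat)) :
  cyclic_abelian_class A C -> exists o, minimizes_cyclic_continuant C o.
Proof.
move=> hC; have [x Cx] := cyclic_abelian_class_nonempty hC.
have [t tx min] := exists_minimal id x.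
have [|y ey] := @word_of_seq _ _ t.
  by rewrite -size_eq0 (perm_size tx) size_eq0 (valP x : wval x != [::]).
subst t; exists (\pi_(cword nat) y); split.
  exact/(cyclic_abelian_class_perm _ hC Cx).
move=> o'; have [z ->] := cword_repr o'.
move/(cyclic_abelian_class_perm _ hC Cx) => zx.
have := min z; rewrite !map_id !cyclic_continuant_pi; apply.
by apply: perm_trans zx _; rewrite perm_sym.
Qed.

Theorem proposition3p7 :
  (forall (d : Order.disp_t) (T : orderType d) (A : {fset T})
     (X : set (set (cword T))),
     symmetric_cyclic_abelian_class A X ->
     (S_alt_sym X #= `I_1)%card)
  /\
  (forall (A : {fset nat}) (C : set (cword nat)),
     (forall a : nat, a \in A -> (2 <= a)%N) ->
     cyclic_abelian_class A C ->
     exists o : cword nat,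
       minimizes_cyclic_continuant C o /\
       forall o' : cword nat,
         minimizes_cyclic_continuant C o' -> bar o' = bar o).
Proof.
split=> [d T A X [C hC ->]|A C A2 hC].
  rewrite /S_alt_sym (bigcup_symmetrize hC).
  have [o So] := S_alt_nonempty hC.
  have -> : symmetrize (S_alt C) = [set bar o]%classic.
    apply/seteqP; split=> [_ [o' So' <-]|_ ->]; first exact: S_alt_bar hC So So'.
    by exists o.
  exact: card_set1.
have [o mo] := minimizer_exists hC; exists o; split=> // o' mo'.
by apply: (S_alt_bar hC); apply: minimizer_S_alt A2 hC _.
Qed.
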